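(* Let $ABC$ be a (non-degenerate) triangle in the Euclidean plane with $AC\neq AB$. Let $r$ and $s$ be the lines perpendicular to $BC$ through $B$ and $C$, respectively. Let $Z$ be the intersection of $r$ with the perpendicular bisector of $AB$, and let $V$ be the intersection of $s$ with the perpendicular bisector of $AC$. Then the following hold. 1. For every fixed $t\in\mathbb{R}$ there is a fixed (depending only on the triangle and $t$) non-degenerate conic section that contains, for every $k\in\mathbb{R}$, the circumcenter of triangle $A\,M_a(k)\,M_a(k+t)$. Such a curve $g$ is said to be from (1), and $t$ is called its span, written $Sp(g)=t$. 2. For every fixed $t\in\mathbb{R}$ there is a fixed non-degenerate conic section that contains, for every $k\in\mathbb{R}\setminus\{0,-t\}$, the circumcenter of triangle $A\,M'_a(k)\,M'_a(k+t)$. Such a curve $g$ is said to be from (2), and $t$ is called its span, written $Sp(g)=t$. 3. For every fixed $t\in\mathbb{R}\setminus\{0\}$ there is a fixed non-degenerate conic section that contains, for every $k\in\mathbb{R}\setminus\{0\}$, the circumcenter of triangle $A\,M'_a(k)\,M_a(k+t)$. Such a curve $g$ is said to be from (3), and $t$ is called its span, written $Sp(g)=t$. 4. $Z$ and $V$ lie on every curve from (1), (2) or (3), and the tangent to every such curve at $Z$ is the perpendicular bisector of $AB$ and at $V$ is the perpendicular bisector of $AC$. 5. If $g$ and $h$ are both from (1), or both from (2), or both from (3), and $|Sp(g)|=|Sp(h)|$, then $g=h$. If $g$ is from (1), $h$ is from (2) and $Sp(h)=Sp(g)$, then $g=h$.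
   Context: For a triangle $ABC$ with $AB\ne AC$ and $x\in\mathbb{R}$, $M_a(x)$ denotes the point on the segment $BC$ such that $BM_a(x):M_a(x)C=\left(\frac{AB}{AC}\right)^{x}$ (ratio of lengths). For $x\in\mathbb{R}$, $x\neq 0$, $M'_a(x)$ denotes the point on the line $BC$ not lying on the segment $BC$ such that $BM'_a(x):M'_a(x)C=\left(\frac{AB}{AC}\right)^{x}$ (ratio of lengths). Convention for $t=0$: the two points on $BC$ coincide, and the ''circumcenter of the triangle $A\,M\,M$'' with $M$ on line $BC$ means the center of the circle through $A$ that is tangent to line $BC$ at $M$ (so it is equidistant from $A$ and from line $BC$). *)

(* Defs.v *)
From HB Require Import structures.
From mathcomp Require Import all_boot all_order all_algebra.
From mathcomp Require Import all_classical all_reals all_analysis.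

Set Implicit Arguments.
Unset Strict Implicit.
Unset Printing Implicit Defensive.

Import Order.TTheory GRing.Theory Num.Theory.
Import numFieldNormedType.Exports.

Local Open Scope classical_set_scope.
Local Open Scope ring_scope.

(* The Euclidean plane is R * R.  The norm that the library puts on a product *)
(* is the max norm, so the Euclidean distance is defined here; the topology   *)
(* of R * R is the usual one.                                                 *)

Section Plane.
Variable R : realType.
Implicit Types (A B C M N O P Q X u v : R * R) (g L : set (R * R)) (x : R).

Definition dotp u v : R := u.1 * v.1 + u.2 * v.2.

Definition cross u v : R := u.1 * v.2 - u.2 * v.1.

Definition eudist P Q : R := Num.sqrt (dotp (Q - P) (Q - P)).

Definition nondegenerate_triangle A B C := cross (B - A) (C - A) != 0.

Definition line_through P v : set (R * R) := range (fun s : R => P + s *: v).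

Definition line P Q : set (R * R) := line_through P (Q - P).

Definition seg P Q : set (R * R) :=
  [set P + s *: (Q - P) | s in [set s : R | 0 <= s <= 1]].

Definition perp_line P A B : set (R * R) :=
  [set X | dotp (X - P) (B - A) = 0].

Definition perp_bisector A B : set (R * R) :=
  perp_line (2^-1 *: (A + B)) A B.

Definition circle O x : set (R * R) := [set X | eudist O X = x].

(* [get D] is a definite description: it is the point of D when D is a        *)
(* singleton.  The ratio of distances is positive, which rules out the        *)
(* endpoints of BC (at M = C the quotient is 0 by convention).  [M'_a 0] is   *)
(* meaningless: no point satisfies its description.                           *)
Definition M_a A B C x : R * R :=
  get [set M | seg B C M /\
    eudist B M / eudist M C = (eudist A B / eudist A C) `^ x].

Definition M'_a A B C x : R * R :=
  get [set M | [/\ line B C M, ~ seg B C M &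
    eudist B M / eudist M C = (eudist A B / eudist A C) `^ x]].

(* M and N are meant to lie on the line BC.  If they coincide, the circle is  *)
(* the one through A that is tangent to BC at M, that is, that meets BC at M  *)
(* only.                                                                      *)
Definition circumcenter A B C M N : R * R :=
  get [set O | if M == N
    then circle O (eudist O A) `&` line B C = [set M]
    else eudist O A = eudist O M /\ eudist O M = eudist O N].

Definition homog P : 'rV[R]_3 := \row_(i < 3) [:: P.1; P.2; 1]`_i.

Definition quadric (S : 'M[R]_3) : set (R * R) :=
  [set P | (homog P *m S *m (homog P)^T) 0 0 = 0].

(* The nonemptiness excludes the imaginary ellipses; with it, an invertible   *)
(* symmetric matrix gives exactly the ellipses, parabolas and hyperbolas.     *)
Definition nondegenerate_conic g :=
  g !=set0 /\ exists S : 'M[R]_3, [/\ S^T = S, \det S != 0 & g = quadric S].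

(* L is the limit position of the secants PX as X tends to P on g: the        *)
(* quotient is, up to the constant factor |v|, the sine of the angle between  *)
(* PX and L.  Since P is a limit point of g, there is at most one such L.     *)
Definition tangent_at g P L :=
  [/\ g P, limit_point g P &
    exists v, [/\ v != 0, L = line_through P v &
      (fun X => cross v (X - P) / eudist P X) @ within g P^' --> (0 : R)]].

(* In [from_i A B C t g] the real number t is the span of the curve g.  The   *)
(* span is a relation and not a function of g: g also has the span - t.       *)
Definition from_1 A B C (t : R) g :=
  nondegenerate_conic g /\
  forall k : R, g (circumcenter A B C (M_a A B C k) (M_a A B C (k + t))).

Definition from_2 A B C (t : R) g :=
  nondegenerate_conic g /\
  forall k : R, k != 0 -> k != - t ->
    g (circumcenter A B C (M'_a A B C k) (M'_a A B C (k + t))).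

Definition from_3 A B C (t : R) g :=
  [/\ t != 0, nondegenerate_conic g &
  forall k : R, k != 0 ->
    g (circumcenter A B C (M'_a A B C k) (M_a A B C (k + t)))].

End Plane.

(* Main.v *)
Require Import Defs.
From HB Require Import structures.
From mathcomp Require Import all_boot all_order all_algebra.
From mathcomp Require Import all_classical all_reals all_analysis.
From mathcomp Require Import ring lra.

(** Let [beta] and [gamma] be the powers of [B] and [C] with respect to the
    circle centred at [P] that passes through [A], in units of [BC ^ 2].  They
    are affine functions of [P] ([powerE]), they vanish on the perpendicular
    bisectors of [AB] and [AC] respectively, and together they are coordinates
    on the plane ([power_of_powers], [of_powersK]).

    If the circle meets [BC] at the abscissas [m] and [n] (0 at [B], 1 at [C]),
    then [beta = m * n] and [gamma = (1 - m) * (1 - n)]; when [m = n] this is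
    tangency ([circumcenter_powers]).  Put [p = m * (1 - n)] and
    [q = (1 - m) * n].  Then [p * q = beta * gamma] and
    [p + q = 1 - beta - gamma].  In all three families the signed ratios in
    which the two points divide [BC] have a quotient [nu] that does not depend
    on [k], which says [q = nu * p].  Eliminating [p] and [q] gives

      [(1 + nu) ^+ 2 * (beta * gamma) = nu * (1 - beta - gamma) ^+ 2],

    the conic [pencil nu].  With [lambda = AB / AC], the quotient [nu] is
    [lambda `^ t] if both points lie inside or both outside the segment, and
    [- lambda `^ t] if one of each; the conic is non-degenerate as soon as [nu]
    is neither 0 nor -1 ([pencil_conic]), and -1 occurs only for [t = 0] in the
    third family.

    The equation shows a conic tangent to [beta = 0] and [gamma = 0] at their
    intersections with [beta + gamma = 1].  These intersections are [Z] and
    [V]: the foot of [P] on [BC] has abscissa [(1 + beta - gamma) / 2]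
    ([perp_foot_power]), so [beta = 0, gamma = 1] describes the point [Z] of the
    bisector of [AB] above [B], and symmetrically for [V].  The tangent lines
    follow from [beta = O(delta ^ 2)] with [delta = 1 - beta - gamma]
    ([pencil_tangent]).

    Finally, a non-degenerate conic containing the centres of one family is
    [pencil nu]: the centres are rationally parametrised with degree 2, so a
    conic containing infinitely many of them satisfies five independent linear
    conditions ([conic_eq_pencil]).  Hence belonging to a family with span [t]
    amounts to an equality with [pencil nu] ([from_1P], [from_2P], [from_3P]),
    and the coincidences between curves come from [pencil nu^-1 = pencil nu]
    ([pencilV]). *)

Set Implicit Arguments.
Unset Strict Implicit.
Unset Printing Implicit Defensive.

Import Order.TTheory GRing.Theory Num.Theory.
Import numFieldNormedType.Exports.

Local Open Scope classical_set_scope.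
Local Open Scope ring_scope.

(** * Distances in the Euclidean plane *)

Section EuclideanPlane.
Variable R : realType.
Implicit Types u v P Q X O M N : R * R.

Lemma dotp_ge0 u : 0 <= dotp u u.
Proof. by rewrite /dotp addr_ge0 // -expr2 sqr_ge0. Qed.

Lemma dotp_eq0 u : (dotp u u == 0) = (u == 0).
Proof.
case: u => a b; rewrite /dotp /= -!expr2.
by rewrite paddr_eq0 ?sqr_ge0 // !sqrf_eq0.
Qed.

Lemma eudistC P Q : eudist P Q = eudist Q P.
Proof. by rewrite /eudist -opprB /dotp /= !mulrNN. Qed.

Lemma eudist_eq O X Y : eudist O X = eudist O Y <->
  dotp (O - X) (O - X) - dotp (O - Y) (O - Y) = 0.
Proof.
rewrite (eudistC O X) (eudistC O Y) /eudist.
split=> /eqP; rewrite ?subr_eq0 ?eqr_sqrt ?dotp_ge0 // => /eqP -> //.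
by rewrite subrr.
Qed.

Lemma eudist_gt0 P Q : (0 < eudist P Q) = (P != Q).
Proof. by rewrite sqrtr_gt0 lt_def dotp_ge0 andbT dotp_eq0 subr_eq0 eq_sym. Qed.

Lemma eudist_scale P Q s u :
  Q - P = s *: u -> eudist P Q = `|s| * Num.sqrt (dotp u u).
Proof.
rewrite /eudist => ->; rewrite -sqrtr_sqr -sqrtrM ?sqr_ge0 //; congr Num.sqrt.
by rewrite /dotp /= /GRing.scale /=; ring.
Qed.

End EuclideanPlane.

(** * Powers of B and C, and the circumcentres *)

Section Triangle.
Variables (R : realType) (A B C : R * R).
Implicit Types (P X O M N : R * R) (m n s x y : R).

(** The power of the point [X] with respect to the circle centred at [P] that
    passes through [A], measured in units of [BC ^ 2].  The choice of the unit
    makes the powers of [B] and [C] depend only on the positions, relative to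
    [B] and [C], of the points where the circle meets [BC]. *)
Definition circle_power X P : R :=
  (dotp (P - X) (P - X) - dotp (P - A) (P - A)) / dotp (C - B) (C - B).

Hypothesis ABC : nondegenerate_triangle A B C.

Lemma C_neq_B : C != B.
Proof.
by apply: contra ABC => /eqP ->; rewrite /cross mulrC subrr.
Qed.

Lemma side_neq0 : dotp (C - B) (C - B) != 0.
Proof. by rewrite dotp_eq0 subr_eq0 C_neq_B. Qed.

(** The quadratic terms in [P] cancel: the power is an affine function of the
    centre. *)
Lemma powerE X P : circle_power X P =
  (2 * dotp P (A - X) + dotp X X - dotp A A) / dotp (C - B) (C - B).
Proof. by rewrite /circle_power; congr (_ / _); rewrite /dotp /=; ring. Qed.

(** Along the line [BC] the power of a point is a monic quadratic polynomial in
    its abscissa [s], so the powers of [B] and [C] (the values at 0 and 1)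
    determine it. *)
Lemma power_on_side P s :
  dotp (P - (B + s *: (C - B))) (P - (B + s *: (C - B))) - dotp (P - A) (P - A)
  = (s ^+ 2 - (1 + circle_power B P - circle_power C P) * s + circle_power B P)
    * dotp (C - B) (C - B).
Proof.
have L0 := side_neq0; rewrite /circle_power.
set L := dotp (C - B) _ in L0 *.
transitivity (s ^+ 2 * L
   - (L + (dotp (P - B) (P - B) - dotp (P - C) (P - C))) * s
   + (dotp (P - B) (P - B) - dotp (P - A) (P - A))).
  by rewrite /L /dotp /= /GRing.scale /=; ring.
by field.
Qed.

Lemma equidistant_on_side O s :
  eudist O (B + s *: (C - B)) = eudist O A <->
  s ^+ 2 - (1 + circle_power B O - circle_power C O) * s + circle_power B O = 0.
Proof.
rewrite eudist_eq power_on_side; split=> [/eqP|->]; last by rewrite mul0r.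
by rewrite mulf_eq0 (negPf side_neq0) orbF => /eqP.
Qed.

(** The centre for which [B] and [C] have the prescribed powers [b] and [c]: by
    [powerE] it solves two linear equations, whose determinant is twice the
    signed area of the triangle. *)
Definition of_powers (b c : R) : R * R := let L := dotp (C - B) (C - B) in
  let u := A - B in let v := A - C in
  let r := (b * L + dotp A A - dotp B B) / 2 in
  let s := (c * L + dotp A A - dotp C C) / 2 in
  ((r * v.2 - s * u.2) / cross u v, (s * u.1 - r * v.1) / cross u v).

Lemma power_of_powers b c :
  circle_power B (of_powers b c) = b /\ circle_power C (of_powers b c) = c.
Proof.
have L0 := side_neq0.
have : cross (A - B) (A - C) != 0.
  by rewrite -[A - B]opprB -[A - C]opprB /cross /= !mulrNN.
rewrite !powerE /of_powers /=.
set L := dotp (C - B) _ in L0 *.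
rewrite /dotp /cross /= => cr0.
by split; field; rewrite cr0 L0.
Qed.

Lemma of_powersK P : of_powers (circle_power B P) (circle_power C P) = P.
Proof.
have L0 := side_neq0.
have : cross (A - B) (A - C) != 0.
  by rewrite -[A - B]opprB -[A - C]opprB /cross /= !mulrNN.
rewrite !powerE /of_powers /=.
set L := dotp (C - B) _ in L0 *.
case: P => p1 p2; rewrite /dotp /cross /= => cr0.
by congr pair; field; rewrite cr0 L0.
Qed.

Lemma side_point_inj : injective (fun s => B + s *: (C - B)).
Proof.
move=> s r /addrI/eqP; rewrite -subr_eq0 -scalerBl scaler_eq0 !subr_eq0.
by rewrite (negPf C_neq_B) orbF => /eqP.
Qed.

(** The circle centred at the circumcentre meets [BC] exactly at the abscissas
    [m] and [n], tangency corresponding to [m = n]; so these are the roots of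
    the polynomial of [power_on_side], which is [(s - m) * (s - n)].  Its values
    at 0 and 1 are the two powers.  This covers the degenerate triangle [AMM]
    without any special treatment in what follows. *)
Lemma circumcenter_powers m n :
  let O := circumcenter A B C (B + m *: (C - B)) (B + n *: (C - B)) in
  circle_power B O = m * n /\ circle_power C O = (1 - m) * (1 - n).
Proof.
rewrite /circumcenter (inj_eq side_point_inj).
have [pB pC] := power_of_powers (m * n) ((1 - m) * (1 - n)).
set W := of_powers _ _ in pB pC.
case: (eqVneq m n) => [<-{n}|mn] in W pB pC *.
  set D : set _ := [set _ | _]; set O := get _; suff : D O.
    move=> /= DO.
    have Dm : (circle O (eudist O A) `&` line B C) (B + m *: (C - B)).
      by rewrite DO.
    have [/equidistant_on_side fm _] := Dm.
    (* The second root of the polynomial also gives a common point of the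
       circle and the line, so it has to be [m] again. *)
    have : [set B + m *: (C - B)]
        (B + (1 + circle_power B O - circle_power C O - m) *: (C - B)).
      rewrite -DO; split; last first.
        by exists (1 + circle_power B O - circle_power C O - m).
      by apply/equidistant_on_side; rewrite -fm; ring.
    move=> /side_point_inj e.
    have s2 : 1 + circle_power B O - circle_power C O = 2 * m by lra.
    by rewrite s2 in fm; split; lra.
  apply: getPex; exists W; rewrite /D /=; apply/seteqP; split=> X.
    move=> [+ [s _ sX]]; rewrite -sX => /equidistant_on_side.
    rewrite pB pC => fs; suff -> : s = m by [].
    apply/eqP; rewrite -subr_eq0 -sqrf_eq0; apply/eqP; rewrite -[RHS]fs; ring.
  move=> ->; split; last by exists m.
  by apply/equidistant_on_side; rewrite pB pC; ring.
set D : set _ := [set _ | _]; set O := get _; suff : D O.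
  move=> [/esym Om On]; move: On; rewrite Om => /esym.
  move/equidistant_on_side => On.
  move/equidistant_on_side: Om => Om.
  have /eqP : (m - n) * (m + n - (1 + circle_power B O - circle_power C O)) = 0.
    by rewrite -[RHS](subrr 0) -{1}Om -On; ring.
  rewrite mulf_eq0 subr_eq0 (negPf mn) /= => /eqP/subr0_eq e.
  by rewrite -e in Om; split; lra.
apply: getPex; exists W.
have e s : (s - m) * (s - n) = 0 -> eudist W (B + s *: (C - B)) = eudist W A.
  by move=> s0; apply/equidistant_on_side; rewrite pB pC -s0; ring.
have em := e m; have en := e n.
by rewrite /D /= em ?en // ?subrr ?mul0r ?mulr0.
Qed.

(** The point [M] of the line [BC] with signed ratio [BM / MC = x]. *)
Definition div_point x := B + (x / (1 + x)) *: (C - B).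

(** The equality also holds at [s = 1], where both denominators vanish. *)
Lemma ratio_on_side s :
  eudist B (B + s *: (C - B)) / eudist (B + s *: (C - B)) C = `|s / (1 - s)|.
Proof.
have -> := @eudist_scale _ B (B + s *: (C - B)) s (C - B); last first.
  by rewrite addrC addKr.
have -> := @eudist_scale _ (B + s *: (C - B)) C (1 - s) (C - B); last first.
  by rewrite scalerBl scale1r opprD addrA.
rewrite -mulf_div divff ?mulr1 ?normf_div //.
by rewrite gt_eqF // sqrtr_gt0 lt_def side_neq0 dotp_ge0.
Qed.

Lemma seg_ratio s : s != 1 -> seg B C (B + s *: (C - B)) <-> 0 <= s / (1 - s).
Proof.
move=> s1; split.
  move=> [r /= /andP[r0 r1] /side_point_inj <-].
  by rewrite divr_ge0 // subr_ge0.
have s1' : 1 - s != 0 by rewrite subr_eq0 eq_sym.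
move=> s0; exists s => //=.
have e : (1 + s / (1 - s)) * (1 - s) = 1 by field.
have : 0 < 1 - s by nra.
move=> p; move: s0; rewrite pmulr_lge0 ?invr_gt0 // => ->/=; lra.
Qed.

Lemma ratio_div_point x : 1 + x != 0 ->
  x / (1 + x) != 1 /\ (x / (1 + x)) / (1 - x / (1 + x)) = x.
Proof.
move=> x0; have e : 1 - x / (1 + x) = (1 + x)^-1 by field.
split; last by rewrite e invrK divfK.
by rewrite -subr_eq0 -oppr_eq0 opprB e invr_eq0.
Qed.

Lemma div_point_ratio s : s != 1 -> div_point (s / (1 - s)) = B + s *: (C - B).
Proof.
rewrite eq_sym -subr_eq0 => s1; rewrite /div_point; congr (_ + _ *: _).
by field; rewrite s1 subrK oner_neq0.
Qed.

Let lambda := eudist A B / eudist A C.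

Lemma lambda_gt0 : 0 < lambda.
Proof.
rewrite divr_gt0 // eudist_gt0; apply: contra ABC => /eqP <-;
  by rewrite subrr /cross /= ?mulr0 ?mul0r subrr.
Qed.

Lemma M_aE k : M_a A B C k = div_point (lambda `^ k).
Proof.
have p := powR_gt0 k lambda_gt0.
have [|n1 e] := @ratio_div_point (lambda `^ k).
  by rewrite gt_eqF // addr_gt0.
apply: get_unique => [|_ [[s s01 <-]]].
  by split; rewrite ?seg_ratio // ?ratio_on_side e ?gtr0_norm ?ltW.
rewrite ratio_on_side -/lambda.
have [->|s1] := eqVneq s 1.
  by rewrite subrr invr0 mulr0 normr0 => z; rewrite -z ltxx in p.
rewrite ger0_norm; last by apply/seg_ratio => //; exists s.
by move=> <-; rewrite div_point_ratio.
Qed.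

Hypothesis lambda_neq1 : lambda != 1.

Lemma lambda_pow_inj : injective (powR lambda).
Proof.
move=> k l e.
have := congr1 (@ln R) e; rewrite !ln_powR => /mulIf; apply.
by rewrite ln_eq0 // lambda_gt0.
Qed.

Lemma lambda_pow_neq1 k : k != 0 -> lambda `^ k != 1.
Proof. by rewrite -(inj_eq lambda_pow_inj) powRr0. Qed.

Lemma M'_aE k : k != 0 -> M'_a A B C k = div_point (- (lambda `^ k)).
Proof.
move=> k0; have p := powR_gt0 k lambda_gt0.
have [|n1 e] := @ratio_div_point (- (lambda `^ k)).
  by rewrite subr_eq0 eq_sym lambda_pow_neq1.
apply: get_unique => [|_ [[s _ <-]]].
  split; first by exists (- lambda `^ k / (1 - lambda `^ k)).
    by rewrite seg_ratio // e oppr_ge0; apply/negP; rewrite -ltNge.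
  by rewrite ratio_on_side e normrN gtr0_norm.
rewrite ratio_on_side -/lambda.
have [->|s1] := eqVneq s 1.
  by rewrite subrr invr0 mulr0 normr0 => _ z; rewrite -z ltxx in p.
rewrite seg_ratio // => /negP; rewrite -ltNge => n <-.
by rewrite ltr0_norm // opprK div_point_ratio.
Qed.

(** Since [m = x / (1 + x)] and [1 - m = (1 + x)^-1], the powers are those of
    [circumcenter_powers]. *)
Lemma center_div_point x y : 1 + x != 0 -> 1 + y != 0 ->
  let O := circumcenter A B C (div_point x) (div_point y) in
  circle_power B O = x * y / ((1 + x) * (1 + y)) /\
  circle_power C O = ((1 + x) * (1 + y))^-1.
Proof.
move=> x0 y0; rewrite /div_point /=.
have [-> ->] := circumcenter_powers (x / (1 + x)) (y / (1 + y)).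
by split; field; rewrite x0 y0.
Qed.

End Triangle.

(** * The bitangent pencil of conics *)

Section Conic.
Variables (R : realType) (A B C : R * R).
Implicit Types (P X O M N : R * R) (x y nu p q b c : R) (g : set (R * R)).

Hypothesis ABC : nondegenerate_triangle A B C.

Notation beta := (circle_power A B C B).
Notation gamma := (circle_power A B C C).

(** For [nu] other than 0 and -1, the conics tangent to the perpendicular
    bisectors [beta = 0] of [AB] and
    [gamma = 0] of [AC] at the points where these meet the line
    [beta + gamma = 1]. *)
Definition pencil nu : set (R * R) :=
  [set P | (1 + nu) ^+ 2 * (beta P * gamma P)
           = nu * (1 - beta P - gamma P) ^+ 2].

(** Barycentric coordinates with respect to the triangle formed by [V], [Z] and
    the circumcentre of [ABC], where [(beta, gamma)] is [(1, 0)], [(0, 1)] and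
    [(0, 0)] respectively. *)
Definition areal b c : 'rV[R]_3 := \row_(i < 3) [:: b; c; 1 - b - c]`_i.

(** The matrix of the change from Cartesian to barycentric coordinates, read off
    from [powerE]. *)
Definition power_mx : 'M[R]_3 := let L := dotp (C - B) (C - B) in
  let coef X := [:: 2 * (A - X).1 / L; 2 * (A - X).2 / L;
                   (dotp X X - dotp A A) / L] in
  \matrix_(i < 3, j < 3)
     [:: (coef B)`_i; (coef C)`_i;
         (i == 2 :> nat)%:R - (coef B)`_i - (coef C)`_i]`_j.

Lemma ord3_ind (K : 'I_3 -> Prop) : K 0 -> K 1 -> K 2%:R -> forall i, K i.
Proof.
move=> K0 K1 K2 [[|[|[|//]]] i3]; [move: K0|move: K1|move: K2];
  by congr K; apply: val_inj.
Qed.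

Lemma homog_power_mx P : homog P *m power_mx = areal (beta P) (gamma P).
Proof.
rewrite !powerE; apply/rowP; elim/ord3_ind;
  rewrite !mxE !big_ord_recl big_ord0 !mxE /= /dotp; ring.
Qed.

(** The rows of its inverse are homogeneous coordinates of the vertices of the
    reference triangle. *)
Lemma power_mx_unit : power_mx \in unitmx.
Proof.
have row3 b c : homog (of_powers A B C b c) *m power_mx = areal b c.
  by rewrite homog_power_mx; have [-> ->] := power_of_powers ABC b c.
suff : (\matrix_(i < 3) homog (of_powers A B C (i == 0)%:R (i == 1)%:R))
  *m power_mx = 1%:M by move/mulmx1_unit => [].
apply/row_matrixP => i; rewrite row_mul rowK row3.
apply/rowP; elim/ord3_ind; move: i; elim/ord3_ind; 
  by rewrite !mxE /= ?subr0 ?subrr.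
Qed.

(** The matrix, in barycentric coordinates, of the quadratic form
    [2 * p * (beta * gamma) + q * (1 - beta - gamma) ^+ 2]. *)
Definition bitangent p q : 'M[R]_3 :=
  \matrix_(i < 3, j < 3)
     (nth [::] [:: [:: 0; p; 0]; [:: p; 0; 0]; [:: 0; 0; q]] i)`_j.

Lemma bitangent_unit p q : p != 0 -> q != 0 -> bitangent p q \in unitmx.
Proof.
move=> p0 q0; suff : bitangent p q *m bitangent p^-1 q^-1 = 1%:M.
  by move/mulmx1_unit => [].
apply/matrixP; elim/ord3_ind; elim/ord3_ind;
  by rewrite !mxE !big_ord_recl big_ord0 !mxE /=
    ?(mulr0, mul0r, addr0, add0r) ?divff.
Qed.

Lemma form3E (S : 'M[R]_3) (v : 'rV[R]_3) : S^T = S ->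
  (v *m S *m v^T) 0 0 =
  S 0 0 * v 0 0 ^+ 2 + S 1 1 * v 0 1 ^+ 2 + S 2%:R 2%:R * v 0 2%:R ^+ 2
  + 2 * (S 0 1 * v 0 0 * v 0 1 + S 0 2%:R * v 0 0 * v 0 2%:R
         + S 1 2%:R * v 0 1 * v 0 2%:R).
Proof.
move=> sym; have e i j : S i j = S j i by rewrite -{1}sym mxE.
have z : ord0 = 0 :> 'I_3 by apply: val_inj.
have l0 : lift ord0 (ord0 : 'I_2) = 1 by apply: val_inj.
have l1 : lift ord0 (lift ord0 (ord0 : 'I_1)) = 2%:R by apply: val_inj.
rewrite !mxE !big_ord_recl big_ord0 !mxE !big_ord_recl !big_ord0 ?mxE l0 l1.
by rewrite z (e 1 0) (e 2%:R 0) (e 2%:R 1); ring.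
Qed.

Lemma arealE b c : (areal b c 0 0 = b) * (areal b c 0 1 = c) *
  (areal b c 0 2%:R = 1 - b - c).
Proof. by rewrite !mxE. Qed.

Lemma form_bitangent p q b c :
  (areal b c *m bitangent p q *m (areal b c)^T) 0 0 =
  2 * p * (b * c) + q * (1 - b - c) ^+ 2.
Proof.
rewrite form3E ?arealE; last first.
  by apply/matrixP; elim/ord3_ind; elim/ord3_ind; rewrite !mxE.
by rewrite !mxE /=; ring.
Qed.

Lemma quadric_congr (S T : 'M[R]_3) : S = power_mx *m T *m power_mx^T ->
  quadric S = [set P | (areal (beta P) (gamma P) *m T
                        *m (areal (beta P) (gamma P))^T) 0 0 = 0].
Proof.
move=> ->; apply/seteqP; split=> P;
  by rewrite /quadric /= -homog_power_mx trmx_mul !mulmxA.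
Qed.

Lemma pencil_conic nu : nu != 0 -> 1 + nu != 0 ->
  nondegenerate_conic (pencil nu).
Proof.
move=> nu0 nu1; split.
  exists (of_powers A B C 0 1); rewrite /pencil /=.
  by have [-> ->] := power_of_powers ABC 0 1; ring.
set T := bitangent ((1 + nu) ^+ 2 / 2) (- nu).
have Tsym : T^T = T.
  by apply/matrixP; elim/ord3_ind; elim/ord3_ind; rewrite !mxE.
exists (power_mx *m T *m power_mx^T); split.
- by rewrite !trmx_mul trmxK Tsym mulmxA.
- rewrite -unitfE -[_ \is a GRing.unit]/(_ \in unitmx) !unitmx_mul unitmx_tr.
  rewrite power_mx_unit bitangent_unit ?oppr_eq0 //.
  by rewrite mulf_neq0 ?expf_neq0 ?invr_eq0 ?pnatr_eq0.
rewrite (quadric_congr erefl); apply/seteqP; split=> P; rewrite /pencil /=;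
  by rewrite form_bitangent; lra.
Qed.

(** Exchanging the roles of the two points on [BC] inverts their ratio [nu], and
    does not change the circle. *)
Lemma pencilV nu : nu != 0 -> pencil nu^-1 = pencil nu.
Proof.
have sub k : k != 0 -> pencil k `<=` pencil k^-1.
  move=> k0 P; rewrite /pencil /=.
  set b := circle_power _ _ _ B P; set c := circle_power _ _ _ C P.
  move=> e; transitivity (k ^- 2 * ((1 + k) ^+ 2 * (b * c))); first by field.
  by rewrite e; field.
move=> nu0; apply/seteqP; split; last exact: sub.
by rewrite -{2}[nu]invrK; apply: sub; rewrite invr_eq0.
Qed.

(** The centre of the circle through [A] and the points of [BC] with signed
    ratios [x] and [nu * x], see [center_div_point].  As [x] varies, this is a
    rational parametrisation of the conic: the barycentric coordinates are
    proportional to [(nu * x ^+ 2, 1, (1 + nu) * x)]. *)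
Definition center_at nu x P :=
  beta P = nu * x ^+ 2 / ((1 + x) * (1 + nu * x)) /\
  gamma P = ((1 + x) * (1 + nu * x))^-1.

Lemma center_at_pencil nu x P : 1 + x != 0 -> 1 + nu * x != 0 ->
  center_at nu x P -> pencil nu P.
Proof.
by move=> x0 y0 [eb ec]; rewrite /pencil /= eb ec; field; rewrite x0 y0.
Qed.

(** Substituting the parametrisation into the equation of a conic gives a
    polynomial of degree at most 4 in [x].  If the conic contains the centres
    for infinitely many [x], this polynomial vanishes identically, and its five
    coefficients leave only one quadratic form up to a factor; the factor is not
    zero, because the conic is non-degenerate. *)
Lemma conic_eq_pencil nu g (xs : nat -> R) : nu != 0 -> 1 + nu != 0 ->
  nondegenerate_conic g -> injective xs ->
  (forall i, 1 + xs i != 0 /\ 1 + nu * xs i != 0) ->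
  (forall i, exists2 O, g O & center_at nu (xs i) O) ->
  g = pencil nu.
Proof.
move=> nu0 nu1 [_ [S [Ssym Sdet gS]]] xs_inj xs0 xsg.
have Wu := power_mx_unit; have WTu : power_mx^T \in unitmx by rewrite unitmx_tr.
have [T ST Tsym] : exists2 T, S = power_mx *m T *m power_mx^T & T^T = T.
  exists (invmx power_mx *m S *m invmx power_mx^T).
    by rewrite !mulmxA mulmxV // mul1mx mulmxKV.
  by rewrite !trmx_mul -trmx_inv !trmxK Ssym trmx_inv !mulmxA.
have gE P : g P <-> T 0 0 * beta P ^+ 2 + T 1 1 * gamma P ^+ 2
    + T 2%:R 2%:R * (1 - beta P - gamma P) ^+ 2
    + 2 * (T 0 1 * beta P * gamma P
           + T 0 2%:R * beta P * (1 - beta P - gamma P)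
           + T 1 2%:R * gamma P * (1 - beta P - gamma P)) = 0.
  by rewrite gS (quadric_congr ST) /= form3E // !arealE.
(* The polynomial in [x] that results from clearing the denominators. *)
pose p := Poly [:: T 1 1; 2 * (1 + nu) * T 1 2%:R;
  2 * nu * T 0 1 + (1 + nu) ^+ 2 * T 2%:R 2%:R;
  2 * nu * (1 + nu) * T 0 2%:R; nu ^+ 2 * T 0 0].
have p0 : p = 0.
  apply: (@roots_geq_poly_eq0 _ _ (map xs (iota 0 5))); first last.
  - by rewrite size_map size_iota (leq_trans (size_Poly _)).
  - by rewrite map_inj_uniq // iota_uniq.
  apply/allP => _ /mapP[i _ ->]; have [Q gQ [eb ec]] := xsg i.
  have := xs0 i; move: (xs i) eb ec => x eb ec [x0 y0].
  move/gE: gQ; rewrite eb ec /root horner_Poly /= => e.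
  set k := ((1 + x) * (1 + nu * x)) ^+ 2.
  apply/eqP; rewrite -[RHS](mulr0 k) -[X in _ = _ * X]e /k.
  by field; rewrite x0 y0.
have pi i : p`_i = 0 by rewrite p0 coef0.
have n2 : 2 != 0 :> R by rewrite pnatr_eq0.
have T11 : T 1 1 = 0 by have := pi 0%N; rewrite coef_Poly.
have T12 : T 1 2%:R = 0.
  have /eqP := pi 1%N; rewrite coef_Poly /= !mulf_eq0 (negPf n2) (negPf nu1).
  by move/eqP.
have T02 : T 0 2%:R = 0.
  have /eqP := pi 3.
  rewrite coef_Poly /= !mulf_eq0 (negPf n2) (negPf nu1) (negPf nu0).
  by move/eqP.
have T00 : T 0 0 = 0.
  have /eqP := pi 4; rewrite coef_Poly /= !mulf_eq0 (negPf nu0).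
  by move/eqP.
have T01 : 2 * nu * T 0 1 + (1 + nu) ^+ 2 * T 2%:R 2%:R = 0.
  by have := pi 2; rewrite coef_Poly.
have T22 : T 2%:R 2%:R != 0.
  apply: contraNneq Sdet => T22.
  have {}T01 : T 0 1 = 0.
    move: T01; rewrite T22 mulr0 addr0 => /eqP.
    by rewrite !mulf_eq0 (negPf n2) (negPf nu0) => /eqP.
  suff T0 : T = 0 by rewrite ST T0 mulmx0 mul0mx det0.
  have sT i j : T i j = T j i by rewrite -{1}Tsym mxE.
  apply/matrixP; elim/ord3_ind; elim/ord3_ind;
    by rewrite mxE // sT.
have T01E : T 0 1 = - (1 + nu) ^+ 2 * T 2%:R 2%:R / (2 * nu).
  apply: (mulfI n2); apply: (mulfI nu0).
  by transitivity (- ((1 + nu) ^+ 2 * T 2%:R 2%:R)); [lra|field].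
apply/seteqP; split=> P; rewrite gE T00 T11 T02 T12 T01E /pencil /=.
  move=> e; apply: (mulfI T22); apply/eqP; rewrite -subr_eq0; apply/eqP.
  by rewrite -[RHS](mulr0 (- nu)) -[X in _ = _ * X]e; field.
move=> e.
transitivity (- T 2%:R 2%:R / nu * ((1 + nu) ^+ 2 * (beta P * gamma P)
           - nu * (1 - beta P - gamma P) ^+ 2)); first by field.
by rewrite e subrr mulr0.
Qed.

End Conic.

(** * The tangents at Z and V *)

Section Tangent.
Variables (R : realType) (A B C : R * R).
Implicit Types (P X Z : R * R) (x y nu b c : R).

Hypothesis ABC : nondegenerate_triangle A B C.

Lemma power_continuous X : continuous (circle_power A B C X).
Proof.
move=> P; rewrite (funext (powerE A B C X)) /dotp.
apply: cvgM; last exact: cvg_cst.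
apply: cvgB; last exact: cvg_cst.
apply: cvgD; last exact: cvg_cst.
apply: cvgM; first exact: cvg_cst.
apply: cvgD; (apply: cvgM; last exact: cvg_cst).
  exact: cvg_fst.
exact: cvg_snd.
Qed.

Lemma of_powers_cvg (T : Type) (F : set_system T) {FF : Filter F}
    (f g : T -> R) b c :
  f @ F --> b -> g @ F --> c ->
  of_powers A B C (f x) (g x) @[x --> F] --> of_powers A B C b c.
Proof.
move=> fb gc; rewrite /of_powers /=.
have lin (k l : R) (h : T -> R) (a : R) : h @ F --> a ->
    (h x * k + dotp A A - l) / 2 @[x --> F] --> (a * k + dotp A A - l) / 2.
  move=> ha; apply: cvgM; last exact: cvg_cst.
  apply: cvgB; last exact: cvg_cst.
  apply: cvgD; last exact: cvg_cst.
  by apply: cvgM; last exact: cvg_cst.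
apply: (@cvg_pair _ _ _ _ (nbhs (_ : R)) (nbhs (_ : R))) => /=;
  (apply: cvgM; last exact: cvg_cst); apply: cvgB;
  (apply: cvgM; last exact: cvg_cst); exact: lin.
Qed.

(** [Z] is the point of parameter [x = 0], so it is approached by the points of
    small non-zero parameter, for which [beta] is not zero. *)
Lemma pencil_limit_point nu Z : nu != 0 ->
  circle_power A B C B Z = 0 -> circle_power A B C C Z = 1 ->
  limit_point (pencil A B C nu) Z.
Proof.
move=> nu0 ZB ZC U UZ.
have idc : x @[x --> (0:R)^'] --> (0:R) by exact: nbhs_dnbhs.
have lin k : 1 + k * x @[x --> (0:R)^'] --> (1:R).
  suff : 1 + k * x @[x --> (0:R)^'] --> 1 + k * 0 by rewrite mulr0 addr0.
  by apply: cvgD; [exact: cvg_cst|apply: cvgM; [exact: cvg_cst|]].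
have lin1 : 1 + x @[x --> (0:R)^'] --> (1:R).
  by have := lin 1; under eq_fun do rewrite mul1r.
have Dc : ((1 + x) * (1 + nu * x))^-1 @[x --> (0:R)^'] --> (1:R).
  suff : ((1 + x) * (1 + nu * x))^-1 @[x --> (0:R)^'] --> (1 * 1 : R)^-1.
    by rewrite mulr1 invr1.
  by apply: cvgV; [rewrite mulr1 oner_neq0|apply: cvgM].
have bc : nu * (x * x) * ((1 + x) * (1 + nu * x))^-1
    @[x --> (0:R)^'] --> (0:R).
  suff : nu * (x * x) * ((1 + x) * (1 + nu * x))^-1
    @[x --> (0:R)^'] --> nu * (0 * 0) * 1 by rewrite !(mulr0, mul0r).
  by apply: cvgM => //; apply: cvgM; [exact: cvg_cst|apply: cvgM].
have ZE : of_powers A B C 0 1 = Z by rewrite -ZB -ZC (of_powersK ABC).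
have := of_powers_cvg bc Dc; rewrite ZE.
set phi := fun x => of_powers _ _ _ _ _ => phiZ.
have : \forall x \near (0:R)^',
    [/\ x != 0, 1 + x != 0, 1 + nu * x != 0 & U (phi x)].
  near=> x; split; near: x.
  - exact: nbhs_dnbhs_neq.
  - by apply: (cvgr_neq0 _ lin1); rewrite oner_neq0.
  - by apply: (cvgr_neq0 _ (lin nu)); rewrite oner_neq0.
  - exact: phiZ.
move=> /filter_ex[x [x0 x1 y1 Ux]]; exists (phi x).
have [pb pc] := power_of_powers ABC (nu * (x * x) / ((1 + x) * (1 + nu * x)))
  ((1 + x) * (1 + nu * x))^-1.
rewrite -expr2 in pb pc; split => //; last first.
  exact: (@center_at_pencil _ _ _ _ _ x).
apply: contraNneq x0 => phiE; move: pb.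
have := phiE; rewrite /phi => ->; rewrite ZB => /esym/eqP.
rewrite !mulf_eq0 invr_eq0 mulf_eq0 (negPf nu0) (negPf x1) (negPf y1) orbF /=.
by rewrite orbF orbb.
Unshelve. all: by end_near. Qed.

(** The unit [BC ^ 2] is symmetric in [B] and [C], so exchanging them exchanges
    [beta] and [gamma] and fixes every conic of the pencil.  This reduces the
    tangent at [V] to the tangent at [Z]. *)
Lemma power_swap X P : circle_power A C B X P = circle_power A B C X P.
Proof. by rewrite /circle_power; congr (_ / _); rewrite /dotp /=; ring. Qed.

Lemma pencil_swap nu : pencil A C B nu = pencil A B C nu.
Proof.
apply/seteqP; split=> P; rewrite /pencil /= !power_swap => e.
  by rewrite [X in _ * X]mulrC e; congr (_ * _ ^+ 2); ring.
by rewrite [X in _ * X]mulrC e; congr (_ * _ ^+ 2); ring.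
Qed.

Lemma perp_bisectorE : perp_bisector A B = [set P | circle_power A B C B P = 0].
Proof.
have L0 := side_neq0 ABC.
have e P : circle_power A B C B P =
    - 2 * dotp (P - 2^-1 *: (A + B)) (B - A) / dotp (C - B) (C - B).
  by rewrite powerE; congr (_ / _); rewrite /dotp /= /GRing.scale /=; field.
apply/seteqP; split=> P; rewrite /perp_bisector /perp_line /= e.
  by move=> ->; rewrite mulr0 mul0r.
by move=> /eqP; rewrite !mulf_eq0 invr_eq0 (negPf L0) orbF oppr_eq0 pnatr_eq0
  => /eqP.
Qed.

Definition rot90 (u : R * R) : R * R := (- u.2, u.1).

Lemma cross_rot90 Z X : circle_power A B C B Z = 0 ->
  cross (rot90 (B - A)) (X - Z) =
  dotp (C - B) (C - B) / 2 * circle_power A B C B X.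
Proof.
move=> Z0; rewrite -[circle_power A B C B X]subr0 -Z0 !powerE.
have L0 := side_neq0 ABC; set L := dotp (C - B) _ in L0 *.
by rewrite /cross /dotp /=; field.
Qed.

Lemma line_through_cross Z v : v != 0 ->
  line_through Z v = [set X | cross v (X - Z) = 0].
Proof.
rewrite -dotp_eq0 => v0; apply/seteqP; split=> X /=.
  by move=> [s _ <-]; rewrite addrC addKr /cross /= /GRing.scale /=; ring.
move=> c0; exists (dotp (X - Z) v / dotp v v) => //.
move: c0 v0; case: X Z v => [x1 x2] [z1 z2] [v1 v2].
rewrite /cross /dotp /= => c0 v0.
have c0' a k : k = k + a * (v1 * (x2 - z2) - v2 * (x1 - z1)).
  by rewrite c0; ring.
congr pair; rewrite /= /GRing.scale /=; apply: (mulIf v0);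
  rewrite mulrDl mulrAC divfK //.
  by rewrite [RHS](c0' v2); ring.
by rewrite [RHS](c0' (- v1)); ring.
Qed.

Lemma perp_bisector_through Z : circle_power A B C B Z = 0 ->
  exists v : R * R, [/\ v != 0, perp_bisector A B = line_through Z v &
    forall X, cross v (X - Z) =
      dotp (C - B) (C - B) / 2 * circle_power A B C B X].
Proof.
move=> Z0; exists (rot90 (B - A)).
have v0 : rot90 (B - A) != 0.
  rewrite -dotp_eq0 /rot90 /dotp /= mulrNN addrC; apply: contra ABC.
  rewrite -/(dotp (B - A) (B - A)) dotp_eq0 => /eqP ->.
  by rewrite /cross !mul0r subrr.
have e X := cross_rot90 X Z0; split=> //.
rewrite line_through_cross // perp_bisectorE; apply/seteqP.
split=> P /=; rewrite e; first by move=> ->; rewrite mulr0.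
have k0 : dotp (C - B) (C - B) / 2 != 0.
  by apply: mulf_neq0; [exact: side_neq0 ABC|rewrite invr_eq0 pnatr_eq0].
by move=> /eqP; rewrite mulf_eq0 (negPf k0) => /eqP.
Qed.

Lemma sqr_dotp_le (u w : R * R) : dotp u w ^+ 2 <= dotp u u * dotp w w.
Proof.
rewrite -subr_ge0.
have -> : dotp u u * dotp w w - dotp u w ^+ 2 = cross u w ^+ 2.
  by rewrite /dotp /cross; ring.
exact: sqr_ge0.
Qed.

(** On the conic [beta] is proportional to [delta ^+ 2 / gamma], where
    [delta = 1 - beta - gamma] vanishes at [Z] and [gamma] equals 1 there.  The
    numerator of the quotient in [tangent_at] is a multiple of [beta], and
    [delta] is affine, hence at most a constant times the distance to [Z]; so
    the quotient is at most a constant times [delta / gamma], which tends to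
    0. *)
Lemma pencil_tangent nu Z : nu != 0 -> 1 + nu != 0 ->
  circle_power A B C B Z = 0 -> circle_power A B C C Z = 1 ->
  tangent_at (pencil A B C nu) Z (perp_bisector A B).
Proof.
move=> nu0 nu1 ZB ZC; split.
- by rewrite /pencil /= ZB ZC; ring.
- exact: pencil_limit_point.
have [v [v0 pbE crossE]] := perp_bisector_through ZB.
exists v; split=> //.
have L0 := side_neq0 ABC; set L := dotp (C - B) _ in L0 crossE *.
(* The opposite of the sum of the gradients of the two powers. *)
pose w := (- (2 / L)) *: (2 *: A - B - C).
pose delta X := 1 - circle_power A B C B X - circle_power A B C C X.
have deltaE X : delta X = dotp (X - Z) w.
  have dZ : delta Z = 0 by rewrite /delta ZB ZC; ring.
  rewrite -[LHS]subr0 -dZ /delta !powerE -/L /w /dotp /= /GRing.scale /=.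
  by field.
have delta_le X : `|delta X| <= Num.sqrt (dotp w w) * eudist Z X.
  rewrite deltaE -sqrtr_sqr /eudist -sqrtrM ?dotp_ge0 // ler_wsqrtr //.
  by rewrite mulrC sqr_dotp_le.
pose k := L / 2 * (nu / (1 + nu) ^+ 2).
pose K := `|k| * Num.sqrt (dotp w w).
have delta_c : delta X @[X --> Z] --> (0:R).
  suff : delta X @[X --> Z] -->
    1 - circle_power A B C B Z - circle_power A B C C Z.
    by rewrite ZB ZC subr0 subrr.
  apply: cvgB; last exact: power_continuous.
  by apply: cvgB; [exact: cvg_cst|exact: power_continuous].
have bound_c :
    K * `|delta X| * `|circle_power A B C C X|^-1 @[X --> Z] --> (0:R).
  suff : K * `|delta X| * `|circle_power A B C C X|^-1 @[X --> Z] -->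
    K * `|0 : R| * `|1 : R|^-1.
    by rewrite normr0 mulr0 mul0r.
  apply: cvgM.
    by apply: cvgM; [exact: cvg_cst|exact: cvg_norm].
  apply: cvgV; first by rewrite normr1 oner_neq0.
  by apply: cvg_norm; rewrite -ZC; exact: power_continuous.
have gammaZ : \forall X \near Z, circle_power A B C C X != 0.
  by apply: (cvgr_neq0 _ (@power_continuous C Z)); rewrite ZC oner_neq0.
apply/cvgr0Pnorm_le => e e0.
rewrite near_withinE; near=> X => PX.
have XZ : X != Z by near: X; exact: nbhs_dnbhs_neq.
have gX : circle_power A B C C X != 0 by near: X; exact: nbhs_dnbhs.
have bX : K * `|delta X| * `|circle_power A B C C X|^-1 <= e.
  rewrite (le_trans (ler_norm _)) //; near: X; apply: nbhs_dnbhs.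
  by move: bound_c => /cvgr0Pnorm_le; apply.
apply: le_trans bX.
have d0 : 0 < eudist Z X by rewrite eudist_gt0 eq_sym.
rewrite normrM normfV (gtr0_norm d0) ler_pdivrMr // crossE.
have -> : circle_power A B C B X =
    nu / (1 + nu) ^+ 2 * (delta X * (delta X / circle_power A B C C X)).
  move: PX; rewrite /pencil /= -/(delta X) => PX.
  apply: (mulfI (expf_neq0 2 nu1)); apply: (mulIf gX); rewrite -mulrA PX.
  by field; rewrite gX nu1.
have -> : L / 2 * (nu / (1 + nu) ^+ 2 *
      (delta X * (delta X / circle_power A B C C X)))
    = k * delta X * (circle_power A B C C X)^-1 * delta X by rewrite /k; ring.
rewrite normrM (normrM _ _^-1) normfV (normrM k).
apply: (le_trans (ler_wpM2l _ (delta_le X))).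
  by rewrite !mulr_ge0 ?invr_ge0.
by rewrite le_eqVlt; apply/orP; left; apply/eqP; rewrite /K; ring.
Unshelve. all: by end_near. Qed.

End Tangent.

(** * The three families of circumcentres *)

Section Loci.
Variables (R : realType) (A B C : R * R).
Implicit Types (P O : R * R) (k t s nu : R) (g : set (R * R)).

Hypothesis ABC : nondegenerate_triangle A B C.
Hypothesis AC_neq_AB : eudist A C != eudist A B.

Let lambda := eudist A B / eudist A C.

Lemma lambda_neq1 : lambda != 1.
Proof.
have [AC0|AC0] := eqVneq (eudist A C) 0.
  by rewrite /lambda AC0 invr0 mulr0 eq_sym oner_neq0.
by rewrite -(inj_eq (mulIf AC0)) divfK // mul1r eq_sym.
Qed.

(** The three families have the same shape: the two points on [BC] have signed
    ratios [x] and [nu * x] with [x = e * lambda `^ k], where [e] is 1 for an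
    inner and -1 for an outer first point.  The set [K] of admissible exponents
    only has to contain all large [k]; the exponents [i + 1 + |t|] avoid both 0
    and [- t]. *)
Lemma locus_eq_pencil (K : set R) (O : R -> R * R) (e t nu : R) g :
  nu != 0 -> 1 + nu != 0 -> e != 0 ->
  (forall k, `|t| < k -> K k) ->
  (forall k, K k ->
    [/\ 1 + e * lambda `^ k != 0, 1 + nu * (e * lambda `^ k) != 0
      & O k = circumcenter A B C (div_point B C (e * lambda `^ k))
                                 (div_point B C (nu * (e * lambda `^ k)))]) ->
  (nondegenerate_conic g /\ forall k, K k -> g (O k)) <-> g = pencil A B C nu.
Proof.
move=> nu0 nu1 e0 K_large OE.
have O_at k : K k -> center_at A B C nu (e * lambda `^ k) (O k).
  move=> /OE[x0 y0 ->]; have [pb pc] := center_div_point ABC x0 y0.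
  by split=> //; rewrite pb; congr (_ / _); ring.
split=> [[gc gO]|->].
  have Kk i : K (i.+1%:R + `|t|) by apply: K_large; rewrite ltrDr ltr0n.
  apply: (@conic_eq_pencil _ _ _ _ ABC _ _
    (fun i => e * lambda `^ (i.+1%:R + `|t|))) => //.
  - move=> i j /(mulfI e0)/(lambda_pow_inj ABC lambda_neq1)/addIr/eqP.
    by rewrite eqr_nat eqSS => /eqP.
  - by move=> i; have [] := OE _ (Kk i).
  - by move=> i; exists (O (i.+1%:R + `|t|)); [exact: gO|exact: O_at].
split; first exact: pencil_conic.
move=> k Kk; have [x0 y0 _] := OE k Kk.
exact: center_at_pencil x0 y0 (O_at k Kk).
Qed.

Let pow_gt0 k : 0 < lambda `^ k := powR_gt0 k (lambda_gt0 ABC).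

Let pow_neq1 k : k != 0 -> lambda `^ k != 1.
Proof. exact: lambda_pow_neq1 ABC lambda_neq1 _. Qed.

Let powD k t : lambda `^ (k + t) = lambda `^ t * lambda `^ k.
Proof.
rewrite mulrC; apply: powRD; apply/implyP => _.
by rewrite gt_eqF // (lambda_gt0 ABC).
Qed.

Lemma from_1P t g : from_1 A B C t g <-> g = pencil A B C (lambda `^ t).
Proof.
rewrite -(@locus_eq_pencil setT
  (fun k => circumcenter A B C (M_a A B C k) (M_a A B C (k + t))) 1 t);
  rewrite ?oner_neq0 ?gt_eqF ?addr_gt0 //.
  by split=> -[gc gO]; split=> // k; exact: gO.
by move=> k _; rewrite mul1r -powD !M_aE // !gt_eqF ?addr_gt0.
Qed.

Lemma from_2P t g : from_2 A B C t g <-> g = pencil A B C (lambda `^ t).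
Proof.
rewrite -(@locus_eq_pencil [set k | k != 0 /\ k != - t]
  (fun k => circumcenter A B C (M'_a A B C k) (M'_a A B C (k + t))) (-1) t);
  rewrite ?oppr_eq0 ?oner_neq0 ?gt_eqF ?addr_gt0 //.
- split=> -[gc gO]; split=> // k; first by move=> [k0 kt]; exact: gO.
  by move=> k0 kt; exact: gO.
- move=> k tk; have := normr_ge0 t; have := ler_norm (- t).
  rewrite normrN => t1 t2.
  by split; rewrite gt_eqF //; lra.
move=> k [k0 kt]; have kt0 : k + t != 0 by rewrite addr_eq0.
rewrite mulN1r mulrN -powD !M'_aE ?lambda_neq1 //.
by rewrite !subr_eq0 ![1 == _]eq_sym !pow_neq1.
Qed.

Lemma from_3P t g : t != 0 ->
  from_3 A B C t g <-> g = pencil A B C (- lambda `^ t).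
Proof.
move=> t0; rewrite -(@locus_eq_pencil [set k | k != 0]
  (fun k => circumcenter A B C (M'_a A B C k) (M_a A B C (k + t))) (-1) t).
- by split=> [[_ gc gO]|[gc gO]]; split.
- by rewrite oppr_eq0 gt_eqF.
- by rewrite subr_eq0 eq_sym pow_neq1.
- by rewrite oppr_eq0 oner_neq0.
- move=> k tk; rewrite /= gt_eqF //; exact: le_lt_trans tk.
move=> k k0; rewrite mulN1r mulrNN -powD M'_aE ?lambda_neq1 // M_aE //.
by rewrite subr_eq0 eq_sym pow_neq1 // gt_eqF ?addr_gt0.
Qed.

(** The foot of [P] on [BC] has abscissa half the sum of the roots in
    [power_on_side], that is [(1 + beta - gamma) / 2]; here it is 0. *)
Lemma perp_foot_power P : perp_line B B C P ->
  circle_power A B C C P = 1 + circle_power A B C B P.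
Proof.
rewrite /perp_line /= => P0; apply/eqP; rewrite eq_sym -subr_eq0; apply/eqP.
have L0 := side_neq0 ABC.
have -> : 1 + circle_power A B C B P - circle_power A B C C P =
    2 * dotp (P - B) (C - B) / dotp (C - B) (C - B).
  rewrite -{1}(divff L0) /circle_power -mulrDl -mulrBl; congr (_ / _).
  by rewrite /dotp /=; ring.
by rewrite P0 mulr0 mul0r.
Qed.

Lemma triangle_swap : nondegenerate_triangle A C B.
Proof.
move: ABC; rewrite /nondegenerate_triangle; apply: contra => /eqP e.
by apply/eqP; rewrite -[RHS]oppr0 -e /cross; ring.
Qed.

End Loci.

Theorem theorem2p1 (R : realType) (A B C Z V : R * R)
  (ABC_triangle : nondegenerate_triangle A B C)
  (AC_neq_AB : eudist A C != eudist A B)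
  (Z_def : perp_line B B C `&` perp_bisector A B = [set Z])
  (V_def : perp_line C B C `&` perp_bisector A C = [set V]) :
  [/\ forall t : R, exists g : set (R * R), from_1 A B C t g,
      forall t : R, exists g : set (R * R), from_2 A B C t g,
      forall t : R, t != 0 -> exists g : set (R * R), from_3 A B C t g,
      forall (t : R) (g : set (R * R)),
        from_1 A B C t g \/ from_2 A B C t g \/ from_3 A B C t g ->
        [/\ g Z, g V,
            tangent_at g Z (perp_bisector A B) &
            tangent_at g V (perp_bisector A C)]
    & (forall (t s : R) (g h : set (R * R)),
        [\/ from_1 A B C t g /\ from_1 A B C s h,
            from_2 A B C t g /\ from_2 A B C s h |
            from_3 A B C t g /\ from_3 A B C s h] ->
        `|t| = `|s| -> g = h) /\
      (forall (t : R) (g h : set (R * R)),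
        from_1 A B C t g -> from_2 A B C t h -> g = h)].
Proof.
have ACB := triangle_swap ABC_triangle.
set lambda := eudist A B / eudist A C.
have l0 t : 0 < lambda `^ t by rewrite powR_gt0 ?(lambda_gt0 ABC_triangle).
have E1 := from_1P ABC_triangle AC_neq_AB.
have E2 := from_2P ABC_triangle AC_neq_AB.
have E3 := from_3P ABC_triangle AC_neq_AB.
have from_3_neq0 t g : from_3 A B C t g -> t != 0 by case.
have [ZB ZC] : circle_power A B C B Z = 0 /\ circle_power A B C C Z = 1.
  have [/(perp_foot_power ABC_triangle) ->] :
    (perp_line B B C `&` perp_bisector A B) Z by rewrite Z_def.
  by rewrite (perp_bisectorE ABC_triangle) /= => ->; rewrite addr0.
have [VC VB] : circle_power A C B C V = 0 /\ circle_power A C B B V = 1.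
  have [+ +] : (perp_line C B C `&` perp_bisector A C) V by rewrite V_def.
  rewrite (perp_bisectorE ACB) /= => VCB VC; split=> //.
  rewrite (perp_foot_power ACB) ?VC ?addr0 //.
  by move: VCB; rewrite /perp_line /= -[B - C]opprB /dotp /= !mulrN => VCB; lra.
have tangents nu : nu != 0 -> 1 + nu != 0 ->
    [/\ pencil A B C nu Z, pencil A B C nu V,
      tangent_at (pencil A B C nu) Z (perp_bisector A B) &
      tangent_at (pencil A B C nu) V (perp_bisector A C)].
  move=> nu0 nu1.
  have tZ := pencil_tangent ABC_triangle nu0 nu1 ZB ZC.
  have := pencil_tangent ACB nu0 nu1 VC VB; rewrite pencil_swap => tV.
  by split=> //; [case: tZ|case: tV].
split.
- by move=> t; exists (pencil A B C (lambda `^ t)); apply/E1.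
- by move=> t; exists (pencil A B C (lambda `^ t)); apply/E2.
- by move=> t t0; exists (pencil A B C (- lambda `^ t)); apply/E3.
- move=> t g [/E1 ->|[/E2 ->|g3]].
  + by apply: tangents; rewrite gt_eqF ?addr_gt0.
  + by apply: tangents; rewrite gt_eqF ?addr_gt0.
  have t0 := from_3_neq0 _ _ g3; move/(E3 _ _ t0): g3 => ->.
  apply: tangents; first by rewrite oppr_eq0 gt_eqF.
  by rewrite subr_eq0 eq_sym (lambda_pow_neq1 ABC_triangle) ?lambda_neq1.
split=> [t s g h gh ts|t g h /E1 -> /E2 ->//].
(* [e] is the sign of [nu]. *)
have pencil_abs e :
    e ^+ 2 = 1 ->
    pencil A B C (e * lambda `^ t) = pencil A B C (e * lambda `^ s).
  move=> e2; have e0 : e != 0.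
    by apply: contra_eq_neq e2 => ->; rewrite expr0n eq_sym oner_neq0.
  have [->//|->] : t = s \/ t = - s.
    by case: (ger0P t) ts; case: (ger0P s) => _ _ ts;
      [left|right|right|left]; lra.
  have es : e * lambda `^ s != 0 by rewrite mulf_neq0 // gt_eqF.
  have eV : e^-1 = e by apply: (mulfI e0); rewrite divff // -expr2 e2.
  by rewrite powRN -(pencilV A B C es) invfM eV.
case: gh => -[].
- move=> /E1 -> /E1 ->.
  by have := pencil_abs 1; rewrite !mul1r; apply; rewrite expr1n.
- move=> /E2 -> /E2 ->.
  by have := pencil_abs 1; rewrite !mul1r; apply; rewrite expr1n.
move=> g3 h3; have t0 := from_3_neq0 _ _ g3; have s0 := from_3_neq0 _ _ h3.
move/(E3 _ _ t0): g3 => ->; move/(E3 _ _ s0): h3 => ->.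
by have := pencil_abs (-1); rewrite !mulN1r; apply; rewrite sqrrN expr1n.
Qed.
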